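(* Let $\mathcal F$ be a Cyclic ACF with $s$ hash selector bits and false positive rate parameter $\epsilon$, with $k=O(1)$ hash tables, each with $N=\Theta(n)$ slots. Then there exists an adversarial strategy, making $\Theta(2^s/\epsilon^{2^s})$ queries, which wins the adaptivity game against $\mathcal F$ with probability $\Omega(1)$. Thus the sustained false positive rate of $\mathcal F$ is $\Omega(1)$.
   Context: Asymptotics are as $n\to\infty$. Cyclic ACF (adaptive cuckoo filter). The filter stores a set $S=\{x_1,\ldots,x_n\}$ from a large universe $U$ ($|U|\gg n$). There are $k$ hash tables (numbered $0,\ldots,k-1$), each with $N$ slots (one slot per bin). Each slot holds an $f$-bit fingerprint and $s$ additional hash selector bits (an integer $\alpha\in\{0,\ldots,2^s-1\}$). The filter uses independent uniformly random hash functions: location hashes $h^\ell_0,\ldots,h^\ell_{k-1}:U\to\{0,\ldots,N-1\}$ and a fingerprint hash $h^f:U\times\{0,\ldots,2^s-1\}\to\{0,\ldots,2^f-1\}$. The parameter $f$ is set to $\log_2(n/(N\epsilon))$ to obtain false positive rate $\epsilon$. Each $x_i\in S$ is stored in one slot $h^\ell_{\beta_i}(x_i)$ of table $\beta_i$ for some $\beta_i\in\{0,\ldots,k-1\}$ found by cuckoo-hashing insertion; distinct elements occupy distinct slots. Initially the selector bits of the slot are $0$ and the slot stores $h^f(x_i,0)$. Query: on query $q$, for each $\beta\in\{0,\ldots,k-1\}$ the filter looks at slot $h^\ell_\beta(q)$ of table $\beta$; if it is occupied, has selector value $\alpha$, and stores a fingerprint equal to $h^f(q,\alpha)$, the filter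 answers ''present''. If no $\beta$ gives a match it answers ''absent''. A query $q\notin S$ answered ''present'' is a false positive. Fixing: after a false positive $q$, for each $x_i\in S$ that collides with $q$, stored in a slot with selector value $\alpha$, the selector is changed to $\alpha+1$ (cyclically, mod $2^s$) and the fingerprint stored in the slot becomes $h^f(x_i,\alpha+1)$. Adaptivity game: an adversary generates a sequence of queries. After each query $q$, both the adversary and the filter learn whether $q$ was a false positive; the filter may change its internal representation in response, and the adversary may use this information to choose later queries. At any time the adversary may name a special element $\hat q$; the adversary wins if $\hat q$ is a false positive at that time, and the filter wins otherwise. The sustained false positive rate of a filter is the maximum probability with which an adversary can win the adaptivity game.
   Formalization: The constant in the upper bound on the number of queries may depend on s when N < n (a constant uniform in s is impossible there), and |U| is assumed at least a constant times n plus the number of queries (with smaller |U| there may be no false positive at all). *)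

(* Defs.v *)
From HB Require Import structures.
From mathcomp Require Import all_boot all_order all_algebra.
From mathcomp Require Import all_classical all_reals.

Set Implicit Arguments.
Unset Strict Implicit.
Unset Printing Implicit Defensive.

Import Order.TTheory GRing.Theory Num.Theory.

Local Open Scope ring_scope.

(* [loc_hash k N U] is the type of families of k location hashes U -> [0, N);
   a uniform element of it is a k-tuple of independent uniform functions. *)
Definition loc_hash (k N : nat) (U : finType) : finType :=
  {ffun 'I_k -> {ffun U -> 'I_N}}.

Definition fp_hash (s f : nat) (U : finType) : finType :=
  {ffun U * 'I_(2 ^ s) -> 'I_(2 ^ f)}.

Lemma sel_gt0 (s : nat) : (0 < 2 ^ s)%N.
Proof. by rewrite expn_gt0. Qed.

Definition sel0 (s : nat) : 'I_(2 ^ s) := Ordinal (sel_gt0 s).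

Definition restrict_hash (k N n : nat) (U : finType) (key : {ffun 'I_n -> U})
    (hl : loc_hash k N U) : {ffun 'I_k -> {ffun 'I_n -> 'I_N}} :=
  [ffun beta => [ffun i => hl beta (key i)]].

(* The stored elements are [key 0, ..., key (n - 1)].  The insertion algorithm
   is arbitrary, except that it sees the location hashes only through their
   values on the stored elements, and that the placement it returns is free of
   collisions: table number [beta i] for [key i], hence slot
   [h (beta i) i] of that table.  [None] is an insertion failure. *)
Record cyclic_acf (U : finType) (n k N s f : nat) := CyclicACF {
  key : {ffun 'I_n -> U};
  insertion : {ffun 'I_k -> {ffun 'I_n -> 'I_N}} -> option {ffun 'I_n -> 'I_k};
  key_inj : injective key;
  insertion_valid : forall h beta, insertion h = Some beta ->
    injective (fun i => (beta i, h (beta i) i));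
  insertion_feasible : exists h, insertion h != None
}.

Section CyclicACF.
Context {U : finType} {n k N s f : nat}.
Context (F : cyclic_acf U n k N s f).
Context (hl : loc_hash k N U) (hf : fp_hash s f U) (beta : {ffun 'I_n -> 'I_k}).

(* Contents of all the slots: [None] if the slot is empty, otherwise a
   fingerprint and a selector value. *)
Definition tables : Type :=
  {ffun 'I_k * 'I_N -> option ('I_(2 ^ f) * 'I_(2 ^ s))}.

Definition home (i : 'I_n) : 'I_k * 'I_N :=
  (beta i, hl (beta i) (key F i)).

Definition occupant (p : 'I_k * 'I_N) : option 'I_n := [pick i | home i == p].

Definition initial_tables : tables :=
  [ffun p => if occupant p is Some i
             then Some (hf (key F i, sel0 s), sel0 s) else None].

Definition slot_match (t : tables) (q : U) (p : 'I_k * 'I_N) : bool :=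
  (hl p.1 q == p.2) &&
  (if t p is Some (phi, alpha) then phi == hf (q, alpha) else false).

Definition present (t : tables) (q : U) : bool :=
  [exists tb : 'I_k, slot_match t q (tb, hl tb q)].

Definition stored (q : U) : bool := [exists i, key F i == q].

Definition false_positive (t : tables) (q : U) : bool :=
  ~~ stored q && present t q.

(* [ordS] is the cyclic successor. *)
Definition fix_tables (t : tables) (q : U) : tables :=
  [ffun p => if slot_match t q p then
               if (occupant p, t p) is (Some i, Some (_, alpha))
               then Some (hf (key F i, ordS alpha), ordS alpha) else t p
             else t p].

Definition respond (t : tables) (q : U) : tables :=
  if false_positive t q then fix_tables t q else t.

End CyclicACF.

(* A deterministic adaptive strategy: name the special element and stop, or
   query an element and go on according to whether it was a false positive. *)
Inductive strategy (U : Type) : Type :=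
| Name of U
| Query of U & (bool -> strategy U).

Fixpoint makes_queries (U : Type) (T : nat) (A : strategy U) : Prop :=
  match A, T with
  | Name _, 0 => True
  | Query _ next, T'.+1 => forall b, makes_queries T' (next b)
  | _, _ => False
  end.

(* A randomized strategy, with a uniform coin. *)
Record adversary (U : Type) := Adversary {
  coins : nat;
  play : 'I_coins.+1 -> strategy U
}.
Arguments play {U} a w.

Fixpoint wins {U : finType} {n k N s f : nat} (F : cyclic_acf U n k N s f)
    (hl : loc_hash k N U) (hf : fp_hash s f U) (beta : {ffun 'I_n -> 'I_k})
    (t : tables) (A : strategy U) : bool :=
  match A with
  | Name q => false_positive F hl hf t q
  | Query q next =>
      wins F hl hf beta (respond F hl hf beta t q)
        (next (false_positive F hl hf t q))
  end.

Definition built {U : finType} {n k N s f : nat} (F : cyclic_acf U n k N s f)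
    (hl : loc_hash k N U) : bool :=
  insertion F (restrict_hash (key F) hl) != None.

Definition wins_game {U : finType} {n k N s f : nat}
    (F : cyclic_acf U n k N s f) (hl : loc_hash k N U) (hf : fp_hash s f U)
    (A : strategy U) : bool :=
  if insertion F (restrict_hash (key F) hl) is Some beta
  then wins F hl hf beta (initial_tables F hl hf beta) A else false.

(* [F] fixes the stored set and the insertion algorithm; the hash functions are
   random.  Probability over the coins and the hash functions, conditional on the
   success of the insertion (i.e. on the filter having been built). *)
Definition win_prob (R : realType) {U : finType} {n k N s f : nat}
    (F : cyclic_acf U n k N s f) (A : adversary U) : R :=
  let Omega := ('I_(coins A).+1 * loc_hash k N U * fp_hash s f U)%type in
  #|[pred w : Omega | wins_game F w.1.2 w.2 (play A w.1.1)]|%:R /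
  #|[pred w : Omega | built F w.1.2]|%:R.

(* The maximum is taken as a supremum, over adversaries making any finite
   number of queries and possibly knowing the stored set. *)
Definition sustained_fpr (R : realType) {U : finType} {n k N s f : nat}
    (F : cyclic_acf U n k N s f) : R :=
  sup (range (win_prob R F)).

(* Main.v *)
Require Import Defs.
From HB Require Import structures.
From mathcomp Require Import all_boot all_order all_algebra.
From mathcomp Require Import all_classical all_reals.
From mathcomp Require Import zify lra ring.

Set Implicit Arguments.
Unset Strict Implicit.
Unset Printing Implicit Defensive.

Import Order.TTheory GRing.Theory Num.Theory.

Local Open Scope ring_scope.

(** Call [q] perpetual if it is not stored and shares with some stored element
    [x], in the table that holds [x], both its location and its fingerprints for
    all [2^s] selector values: it is then a false positive forever.  Conversely,
    if [q] is not perpetual, each of the [k] slots that it probes has a selector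
    value at which fingerprints differ, so [q] cannot be a false positive
    [k (2^s - 1) + 1] times in a row.  Hence repeated queries detect perpetual
    elements.

    The hashes at an unstored [q] are independent of the stored data; as a
    location in a table is matched by at most one stored element, [q] is
    perpetual with probability at least [n / (k N 2^(f 2^s))], which is at least
    [eps^(2^s) min(1, a)^(2^s - 1) / k].  The events are independent for distinct [q], so
    a constant multiple of the inverse of this bound suffices.  As the stored set is unknown, the
    adversary takes a cyclic interval of the universe with a random origin, and
    by Markov's inequality at most half of it is stored, with probability at
    least 1/2. *)

(** * Cyclic distance between selector values, in successor steps *)

Definition ord_dist (m : nat) (x y : 'I_m) : nat := ((y + m - x) %% m)%N.

Lemma ord_dist_lt (m : nat) (x y : 'I_m) : (ord_dist x y < m)%N.
Proof. by rewrite /ord_dist ltn_mod; case: x => x /=; case: m {y}. Qed.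

Lemma ord_dist_ordS (m : nat) (x y : 'I_m) :
  x != y -> (ord_dist (ordS x) y < ord_dist x y)%N.
Proof.
rewrite -val_eqE /ord_dist /=.
case: x y => x ltxm [y ltym] /= neqxy.
have modE (z : nat) : (z < m)%N ->
    ((y + m - z) %% m = if z <= y then y - z else y + m - z)%N.
  move=> ltzm; case: leqP => lezy; last by rewrite modn_small //; lia.
  by have -> : (y + m - z = m + (y - z))%N by [lia]; rewrite modnDl modn_small //; lia.
case: (ltnP x.+1 m) => [ltx1m|lemx1].
  by rewrite (modn_small ltx1m) !modE //; case: (ltnP x y); case: (leqP x y); lia.
have -> : x.+1 = m by lia.
by rewrite modnn !modE ?leq0n; first case: (leqP x y); lia.
Qed.

(** * The adversary's strategy *)

Section Attack.
Variable U : Type.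

(** All [m] queries are made whatever the answers, which fixes their number; [next] learns whether
    every one was a false positive. *)
Fixpoint probe (m : nat) (u : U) (next : bool -> strategy U) : strategy U :=
  if m is m'.+1 then Query u (fun b => probe m' u (fun ok => next (b && ok)))
  else next true.

(** Overwriting [found] is harmless: for [m] large enough, only perpetual elements pass a probe. *)
Fixpoint attack (m : nat) (us : seq U) (found : U) : strategy U :=
  if us is u :: us' then
    probe m u (fun ok => attack m us' (if ok then u else found))
  else Name found.

Lemma makes_queries_probe (m T : nat) (u : U) (next : bool -> strategy U) :
  (forall ok, makes_queries T (next ok)) ->
  makes_queries (m + T) (probe m u next).
Proof.
by elim: m next => [|m IHm] next nextT //= b; apply: IHm => ok; apply: nextT.
Qed.

Lemma makes_queries_attack (m : nat) (us : seq U) (found : U) :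
  makes_queries (size us * m) (attack m us found).
Proof.
elim: us found => [|u us IHus] found //=.
by rewrite mulSn; apply: makes_queries_probe.
Qed.

End Attack.

(** * Evolution of the filter under repeated queries *)

Section Filter.
Context {U : finType} {n k N s f : nat}.
Context (F : cyclic_acf U n k N s f).
Context (hl : loc_hash k N U) (hf : fp_hash s f U) (beta : {ffun 'I_n -> 'I_k}).

Definition perpetual (q : U) : bool :=
  ~~ stored F q &&
  [exists i, (hl (beta i) q == hl (beta i) (key F i)) &&
             [forall al, hf (key F i, al) == hf (q, al)]].

(** The form of every reachable state: occupants never move, and a fingerprint is determined by
    occupant and selector, so only selectors evolve. *)
Definition tables_of (sel : {ffun 'I_k * 'I_N -> 'I_(2 ^ s)}) :
    @tables k N s f :=
  [ffun p => if occupant F hl beta p is Some i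
             then Some (hf (key F i, sel p), sel p) else None].

Lemma initial_tablesE :
  initial_tables F hl hf beta = tables_of [ffun=> sel0 s].
Proof. by apply/ffunP => p; rewrite !ffunE; case: occupant => // i; rewrite ffunE. Qed.

Lemma slot_match_tables_of sel q p :
  slot_match hl hf (tables_of sel) q p =
  (hl p.1 q == p.2) &&
  (if occupant F hl beta p is Some i
   then hf (key F i, sel p) == hf (q, sel p) else false).
Proof. by rewrite /slot_match ffunE; case: occupant. Qed.

Definition advance q (sel : {ffun 'I_k * 'I_N -> 'I_(2 ^ s)}) :
    {ffun 'I_k * 'I_N -> 'I_(2 ^ s)} :=
  [ffun p => if false_positive F hl hf (tables_of sel) q &&
                slot_match hl hf (tables_of sel) q p
             then ordS (sel p) else sel p].

Lemma respond_tables_of sel q :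
  respond F hl hf beta (tables_of sel) q = tables_of (advance q sel).
Proof.
rewrite /respond; case: ifP => fpq; apply/ffunP => p.
  rewrite [LHS]ffunE [tables_of (advance _ _) p]ffunE [advance q sel p]ffunE fpq.
  rewrite [slot_match _ _ _ _ _ in LHS]slot_match_tables_of.
  rewrite [slot_match _ _ _ _ _ in RHS]slot_match_tables_of.
  rewrite [tables_of sel p]ffunE /=.
  by case occp: occupant => [i|]; case: ifP => //; rewrite occp.
by rewrite !ffunE fpq.
Qed.

Hypothesis home_inj : injective (home F hl beta).

(** Fingerprints agree at every selector value, and injectivity of [home] identifies the occupant of
    the shared slot. *)
Lemma perpetual_false_positive sel q :
  perpetual q -> false_positive F hl hf (tables_of sel) q.
Proof.
move=> /andP[nstq /existsP[i /andP[/eqP locq /forallP fpq]]].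
rewrite /false_positive nstq; apply/existsP; exists (beta i).
rewrite slot_match_tables_of /= eqxx /= /occupant.
case: pickP => [j /eqP homej|/(_ i)]; last by rewrite /home locq eqxx.
suff -> : j = i by [].
by apply: home_inj; rewrite homej locq.
Qed.

(* [Phi] adds up, over the slots probed by [q], the cyclic distance from the
   selector to a value at which the fingerprints of [q] and the occupant differ. *)
Lemma potential q : ~~ stored F q -> ~~ perpetual q ->
  exists Phi : {ffun 'I_k * 'I_N -> 'I_(2 ^ s)} -> nat,
    (forall sel, (Phi sel <= k * (2 ^ s).-1)%N) /\
    forall sel, false_positive F hl hf (tables_of sel) q ->
      (Phi (advance q sel) < Phi sel)%N.
Proof.
move=> nstq; rewrite /perpetual nstq /= negb_exists => /forallP nperp.
pose slot b := (b, hl b q).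
have mismatch b : {al | forall i, occupant F hl beta (slot b) = Some i ->
    hf (key F i, al) != hf (q, al)}.
  case occb: occupant => [i|]; last by exists (sel0 s).
  have /sigW[al alP] : exists al, hf (key F i, al) != hf (q, al).
    apply/existsP; rewrite -negb_forall.
    have := nperp i; rewrite negb_and; case/orP => //.
    move: occb; rewrite /occupant; case: pickP => // j /eqP homej [<-].
    by case: homej => -> ->; rewrite eqxx.
  by exists al => _ [<-].
pose al b := sval (mismatch b).
exists (fun sel => \sum_b ord_dist (sel (slot b)) (al b))%N; split=> [sel|sel fpq].
  rewrite -[X in (X * _)%N]card_ord -sum_nat_const; apply: leq_sum => b _.
  by rewrite -ltnS prednK ?expn_gt0 // ord_dist_lt.
(* A matching slot does not have its selector at the mismatch value, so the successor brings it
   closer. *)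
have step b : slot_match hl hf (tables_of sel) q (slot b) ->
    (ord_dist (advance q sel (slot b)) (al b) < ord_dist (sel (slot b)) (al b))%N.
  move=> mb; rewrite ffunE fpq mb; apply: ord_dist_ordS.
  move: mb; rewrite slot_match_tables_of eqxx /=.
  case occb: occupant => [i|] // fpb.
  by apply: contraTneq fpb => ->; apply: (svalP (mismatch b)).
have /andP[_ /existsP[b mb]] := fpq.
rewrite (bigD1 b) //= [X in (_ < X)%N](bigD1 b) //= -addSn leq_add //.
  exact: step.
apply: leq_sum => c _.
case mc: (slot_match hl hf (tables_of sel) q (slot c)); first exact/ltnW/step.
by rewrite ffunE mc andbF.
Qed.

Lemma not_perpetual q m sel : (k * (2 ^ s).-1 < m)%N ->
  ~~ stored F q -> ~~ perpetual q ->
  exists2 j, (j < m)%N &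
    ~~ false_positive F hl hf (tables_of (iter j (advance q) sel)) q.
Proof.
move=> lem nstq nperp; have [Phi [Phi_le Phi_lt]] := potential nstq nperp.
have {lem}: (Phi sel < m)%N by apply: leq_ltn_trans lem.
elim: m sel => // m IHm sel ltPhi.
case fpq: (false_positive F hl hf (tables_of sel) q); last first.
  by exists 0%N; rewrite //= fpq.
have [j ltjm nfp] := IHm (advance q sel) (leq_trans (Phi_lt _ fpq) ltPhi).
by exists j.+1; rewrite // iterSr.
Qed.

(** [advance] changes nothing after a negative answer, so one iterate describes the state whatever
    the answers. *)
Lemma wins_probe m u next sel :
  wins F hl hf beta (tables_of sel) (probe m u next) =
  wins F hl hf beta (tables_of (iter m (advance u) sel))
    (next [forall j : 'I_m,
       false_positive F hl hf (tables_of (iter j (advance u) sel)) u]).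
Proof.
elim: m next sel => [|m IHm] next sel.
  by rewrite /=; congr (wins _ _ _ _ _ (next _)); apply/esym/forallP => -[].
rewrite [probe _ _ _]/= [LHS]/= respond_tables_of IHm -iterSr.
congr (wins _ _ _ _ _ (next _)).
apply/andP/forallP => [[fp0 /forallP fpS] [[|j] ltj]|fp] //=.
  by have := fpS (Ordinal (ltj : (j < m)%N)); rewrite -iterSr.
split; first exact: (fp ord0).
by apply/forallP => j; rewrite -iterSr; apply: (fp (lift ord0 j)).
Qed.

(** The disjunction is a loop invariant: perpetual elements pass their probe, and only they do. *)
Lemma wins_attack m us found sel : (k * (2 ^ s).-1 < m)%N ->
  perpetual found || has perpetual us ->
  wins F hl hf beta (tables_of sel) (attack m us found).
Proof.
move=> lem; elim: us found sel => [|u us IHus] found sel.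
  by rewrite /= orbF; apply: perpetual_false_positive.
rewrite [attack _ _ _]/= wins_probe [has _ _]/= => perp; apply: IHus.
case: ifPn => [/forallP fpu|nfpu].
  case perpu: (perpetual u) => //.
  (* As [m] is positive, the first answer already shows that [u] is not stored. *)
  have nstu : ~~ stored F u.
    by case: m lem fpu => // m _ /(_ ord0)/andP[].
  have [j ltjm] := not_perpetual sel lem nstu (negbT perpu).
  by rewrite (fpu (Ordinal ltjm)).
case/or3P: perp => [->|perpu|->]; rewrite ?orbT //.
case/negP: nfpu; apply/forallP => j; exact: perpetual_false_positive.
Qed.

End Filter.

(** * Independence, by resampling the hashes at one element *)

Section Resampling.
Context {U : finType} {n k N s f : nat}.
Context (F : cyclic_acf U n k N s f).

Let hashes := (loc_hash k N U * fp_hash s f U)%type.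
Let point_hashes :=
  ({ffun 'I_k -> 'I_N} * {ffun 'I_(2 ^ s) -> 'I_(2 ^ f)})%type.

Definition hashes_at (q : U) (w : hashes) : point_hashes :=
  ([ffun b => w.1 b q], [ffun al => w.2 (q, al)]).

Definition resample (q : U) (w : hashes) (d : point_hashes) : hashes :=
  ([ffun b => [ffun u => if u == q then d.1 b else w.1 b u]],
   [ffun x => if x.1 == q then d.2 x.2 else w.2 x]).

Lemma hashes_at_resample q w d : hashes_at q (resample q w d) = d.
Proof.
by case: d => d1 d2; congr pair; apply/ffunP => x; rewrite !ffunE /= ?ffunE /= eqxx.
Qed.

Lemma resample_hashes_at q w d : resample q (resample q w d) (hashes_at q w) = w.
Proof.
case: w => hl hf; congr pair; apply/ffunP => x.
  by apply/ffunP => u; rewrite !ffunE; case: eqP => // ->.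
by case: x => u al; rewrite !ffunE /= ?ffunE /=; case: eqP => // ->.
Qed.

(* [(w, d) |-> (resample q w d, hashes_at q w)] is an involution. *)
Lemma sum_resample q (G : hashes -> nat) :
  (\sum_w \sum_d G (resample q w d) = #|{: point_hashes}| * \sum_w G w)%N.
Proof.
rewrite pair_big /=.
rewrite (reindex_inj (h := fun x => (resample q x.1 x.2, hashes_at q x.1))).
  rewrite -(pair_big xpredT xpredT
    (fun w d => G (resample q (resample q w d) (hashes_at q w)))) /=.
  under eq_bigr => w _ do under eq_bigr => d _ do rewrite resample_hashes_at.
  by under eq_bigr => w _ do rewrite sum_nat_const; rewrite big_distrr.
apply: (can_inj (g := fun x => (resample q x.1 x.2, hashes_at q x.1))) => -[w d] /=.
by rewrite resample_hashes_at hashes_at_resample.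
Qed.

(** Perpetuality as an event of the hashes alone: the placement is recomputed from them. *)
Definition everlasting (w : hashes) (q : U) : bool :=
  if insertion F (restrict_hash (key F) w.1) is Some beta
  then perpetual F w.1 w.2 beta q else false.

Lemma restrict_resample q w d : ~~ stored F q ->
  restrict_hash (key F) (resample q w d).1 = restrict_hash (key F) w.1.
Proof.
rewrite negb_exists => /forallP nkey.
by apply/ffunP => b; apply/ffunP => i; rewrite !ffunE (negbTE (nkey i)).
Qed.

Lemma built_resample q w d : ~~ stored F q ->
  built F (resample q w d).1 = built F w.1.
Proof. by move=> nstq; rewrite /built restrict_resample. Qed.

(** Only the hashes at [q'] and at stored elements matter; this is the source of independence. *)
Lemma everlasting_resample q q' w d : ~~ stored F q -> q' != q ->
  everlasting (resample q w d) q' = everlasting w q'.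
Proof.
move=> nstq neq; rewrite /everlasting restrict_resample //.
case: insertion => // beta; congr (_ && _); apply: eq_existsb => i.
move: nstq; rewrite negb_exists => /forallP nkey.
rewrite !ffunE (negbTE neq) (negbTE (nkey i)); congr (_ && _).
by apply: eq_forallb => al; rewrite !ffunE /= (negbTE neq) (negbTE (nkey i)).
Qed.

(** Overwriting one location and all fingerprints by the prescribed values is injective once the old
    values are recorded. *)
Lemma card_hit (b : 'I_k) (x : 'I_N) (g : {ffun 'I_(2 ^ s) -> 'I_(2 ^ f)}) :
  (#|{: point_hashes}| <= N * (2 ^ f) ^ (2 ^ s) *
     #|[set d : point_hashes | (d.1 b == x) && (d.2 == g)]|)%N.
Proof.
pose phi (d : point_hashes) := ((d.1 b, d.2),
   ([ffun c => if c == b then x else d.1 c], g) : point_hashes).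
have phi_inj : injective phi.
  move=> [v1 g1] [v2 g2] /= [] eqb -> /ffunP eqv; congr pair.
  by apply/ffunP => c; have := eqv c; rewrite !ffunE; case: eqP => // ->.
rewrite -cardsT -(card_imset _ phi_inj).
have -> : (N * (2 ^ f) ^ (2 ^ s) =
    #|[set: 'I_N * {ffun 'I_(2 ^ s) -> 'I_(2 ^ f)}]|)%N.
  by rewrite cardsT card_prod card_ffun !card_ord.
rewrite -cardsX; apply/subset_leq_card/fintype.subsetP => _ /imsetP[d _ ->].
by rewrite !inE /= ffunE !eqxx.
Qed.

(* Double counting of the pairs ([d], stored element hit by [d]): at most one
   stored element per table is hit. *)
Lemma card_everlasting q w : ~~ stored F q -> built F w.1 ->
  (n * #|{: point_hashes}| <= k * (N * (2 ^ f) ^ (2 ^ s)) *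
     \sum_d everlasting (resample q w d) q)%N.
Proof.
move=> nstq; rewrite /built.
case ins: insertion => [beta|] // _.
pose hit i := [set d : point_hashes |
   (d.1 (beta i) == w.1 (beta i) (key F i)) && (d.2 == [ffun al => w.2 (key F i, al)])].
have everE d : everlasting (resample q w d) q = [exists i, d \in hit i].
  rewrite /everlasting restrict_resample // ins /perpetual nstq /=.
  apply: eq_existsb => i; rewrite inE.
  move: (nstq); rewrite negb_exists => /forallP nkey.
  rewrite !ffunE eqxx (negbTE (nkey i)); congr (_ && _).
  apply/forallP/eqP => [eqd|-> al].
    by apply/ffunP => al; have /eqP := eqd al; rewrite !ffunE /= eqxx (negbTE (nkey i)).
  by rewrite !ffunE /= eqxx (negbTE (nkey i)).
have le_hit : (\sum_i #|hit i| <= k * \sum_d everlasting (resample q w d) q)%N.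
  under eq_bigr => i _ do rewrite -sum1_card big_mkcond /=.
  rewrite exchange_big /= big_distrr /=; apply: leq_sum => d _.
  rewrite everE -big_mkcond /= sum1_card; case: existsP => [_|nhit]; last first.
    rewrite muln0 leqn0; apply/eqP/eq_card0 => i; apply/negP => hiti.
    by apply: nhit; exists i.
  rewrite muln1 -[X in (_ <= X)%N]card_ord.
  (* Elements hit by the same [d] lie in different tables: within one table they would share a
     slot. *)
  rewrite -(@card_in_image _ _ beta [pred i | d \in hit i]) ?max_card // => i j.
  rewrite !inE => /andP[/eqP loci _] /andP[/eqP locj _] eqb.
  apply: (insertion_valid ins) => /=; congr pair => //.
  by rewrite !ffunE -loci -locj eqb.
rewrite (mulnC k) -mulnA; apply: leq_trans (leq_mul (leqnn _) le_hit).
rewrite big_distrr /= -[n in (n * _)%N]card_ord -sum_nat_const.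
by apply: leq_sum => i _; exact: card_hit.
Qed.

(** Once the filter is built, a fraction at least [P] of the hashes at [q] makes it everlasting, and
    resampling them does not affect the rest of [Q]; so each element contributes a factor
    [1 - P]. *)
Lemma card_no_everlasting (R : realFieldType) (P : R) (Q : seq U) :
  (0 < k)%N -> (0 < N)%N -> 0 <= P <= 1 -> P * (k * (N * (2 ^ f) ^ (2 ^ s)))%:R <= n%:R ->
  uniq Q -> all (fun q => ~~ stored F q) Q ->
  #|[pred w : hashes | built F w.1 && ~~ has (everlasting w) Q]|%:R <=
  (1 - P) ^+ size Q * #|[pred w : hashes | built F w.1]|%:R.
Proof.
move=> k_gt0 N_gt0 /andP[P_ge0 P_le1] leP; elim: Q => [|q Q IHQ] /=.
  by rewrite mul1r ler_nat => _ _; apply/subset_leq_card/fintype.subsetP => w /andP[].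
move=> /andP[qQ uQ] /andP[nstq nstQ].
apply: le_trans (_ : (1 - P) * #|[pred w : hashes |
    built F w.1 && ~~ has (everlasting w) Q]|%:R <= _); last first.
  by rewrite exprS -mulrA ler_wpM2l ?subr_ge0 ?IHQ.
pose B w := built F w.1 && ~~ has (everlasting w) Q.
have B_resample w d : B (resample q w d) = B w.
  rewrite /B built_resample //; congr (_ && ~~ _).
  apply: eq_in_has => q' q'Q; apply: everlasting_resample => //.
  by apply: contraNneq qQ => <-.
set D := #|{: point_hashes}|.
have D_gt0 : (0 < D%:R :> R).
  by rewrite ltr0n /D card_prod !card_ffun !card_ord muln_gt0 !expn_gt0 N_gt0.
have -> : #|[pred w : hashes |
      built F w.1 && ~~ (everlasting w q || has (everlasting w) Q)]| =
    (\sum_(w : hashes) (B w && ~~ everlasting w q))%N.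
  rewrite -sum1_card big_mkcond /=; apply: eq_bigr => w _.
  rewrite inE negb_or andbCA [X in if X then _ else _]andbC -/(B w).
  by case: andP.
rewrite -(ler_pM2l D_gt0) -natrM -(sum_resample q) natr_sum.
have -> : #|[pred w : hashes | built F w.1 && ~~ has (everlasting w) Q]| =
    (\sum_(w : hashes) B w)%N.
  by rewrite -sum1_card big_mkcond /=; apply: eq_bigr => w _;
  rewrite inE -/(B w); case: (B w).
rewrite natr_sum !mulr_sumr; apply: ler_sum => w _.
under eq_bigr => d _ do rewrite B_resample.
case Bw: (B w) => /=; last by rewrite big1 // !mulr0.
have noE : (\sum_d ~~ everlasting (resample q w d) q +
    \sum_d everlasting (resample q w d) q = D)%N.
  by rewrite -big_split /= /D -sum1_card; apply: eq_bigr => d _; case: everlasting.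
have /andP[built_w _] := Bw.
have := card_everlasting nstq built_w; rewrite -/D -(ler_nat R) natrM [leRHS]natrM.
move: leP; set kX := (k * _)%N.
set y := (\sum_d nat_of_bool (everlasting _ _))%N => leP ley.
have kX_gt0 : 0 < kX%:R :> R by rewrite ltr0n !muln_gt0 k_gt0 N_gt0 !expn_gt0.
have le_y : P * D%:R <= y%:R.
  rewrite -(ler_pM2l kX_gt0) mulrA [kX%:R * P]mulrC.
  by apply: le_trans ley; rewrite ler_pM2r.
rewrite mulr1 mulrBr mulr1 lerBrDr [D%:R * P]mulrC.
by rewrite -[D in leRHS]noE natrD lerD2l.
Qed.

End Resampling.

Lemma expr_onem_le_half (R : realFieldType) (P : R) (r : nat) :
  0 <= P <= 1 -> 1 <= r%:R * P -> (1 - P) ^+ r <= 2^-1.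
Proof.
move=> /andP[P_ge0 P_le1] rP_ge1.
have bernoulli : (1 - P) ^+ r * (1 + r%:R * P) <= 1.
  elim: r {rP_ge1} => [|r IHr]; first by rewrite expr0 mul0r addr0 mulr1.
  apply: le_trans IHr; rewrite exprSr -mulrA ler_wpM2l ?exprn_ge0 ?subr_ge0 //.
  by rewrite -natr1; have := ler0n R r; nra.
rewrite -[leRHS]mul1r ler_pdivlMr // (le_trans _ bernoulli) //.
by rewrite ler_wpM2l ?exprn_ge0 ?subr_ge0 //; lra.
Qed.

Lemma sum_pair_assoc (A B C : finType) (G : A -> B * C -> bool) :
  #|[pred w : A * B * C | G w.1.1 (w.1.2, w.2)]| =
  (\sum_a #|[pred h | G a h]|)%N.
Proof.
under [RHS]eq_bigr => a _ do rewrite -sum1_card.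
rewrite pair_big_dep /= -sum1_card.
rewrite (reindex (fun x : A * (B * C) => ((x.1, x.2.1), x.2.2))) /=.
  by apply: eq_bigl => -[a [b c]].
exists (fun y : A * B * C => (y.1.1, (y.1.2, y.2))) => [x _|y _]; first by case: x => a [].
by case: y => -[].
Qed.

(** * Cyclic intervals of the universe *)

Section Block.
Context {U : finType} (u0 : U) (M : nat).

Definition block (w : nat) : seq U :=
  [seq nth u0 (enum U) ((w + j) %% #|U|) | j <- iota 0 M].

Let V_gt0 : (0 < #|U|)%N.
Proof. by apply/card_gt0P; exists u0. Qed.

Lemma block_uniq w : (M <= #|U|)%N -> uniq (block w).
Proof.
move=> leMV; rewrite map_inj_in_uniq ?iota_uniq // => i j.
rewrite !mem_iota !add0n /= => ltiM ltjM /eqP.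
rewrite nth_uniq ?enum_uniq -?cardE ?ltn_mod // eqn_modDl.
by rewrite !modn_small ?(leq_trans _ leMV) // => /eqP.
Qed.

(** As the origin varies, each position of the block takes distinct values, so it meets [p] at most
    [#|p|] times. *)
Lemma sum_count_block (p : pred U) :
  (\sum_(w < #|U|) count p (block w) <= M * #|p|)%N.
Proof.
under eq_bigr => w _ do rewrite count_map -sum1_count big_mkcond /=.
rewrite exchange_big /= -[X in (X * _)%N](size_iota 0) -sum1_size big_distrl /=.
apply: leq_sum => j _; rewrite mul1n -big_mkcond sum1_card /=.
pose shift (w : 'I_#|U|) := nth u0 (enum U) ((w + j) %% #|U|).
rewrite -(@card_in_image _ _ shift [pred w | p (shift w)]).
  by apply/subset_leq_card/fintype.subsetP => u /mapP[w]; rewrite mem_enum => pw ->.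
move=> w w' _ _ /eqP; rewrite nth_uniq ?enum_uniq -?cardE ?ltn_mod // eqn_modDr.
by rewrite !modn_small // => /eqP/val_inj.
Qed.

(** Markov's inequality: a block has at most [M / 4] elements in [p] on average. *)
Lemma card_sparse_block (p : pred U) : (0 < M)%N -> (4 * #|p| <= #|U|)%N ->
  (#|U| <= 2 * #|[pred w : 'I_#|U| | (2 * count p (block w) <= M)%N]|)%N.
Proof.
move=> M_gt0 le_p; set good := [pred w | _].
have : (M * #|[predC good]| <= 2 * (M * #|p|))%N.
  apply: leq_trans (leq_mul (leqnn 2) (sum_count_block p)).
  rewrite mulnC -sum_nat_const big_distrr /= [leqRHS](bigID [in predC good]) /=.
  apply: leq_trans (leq_addr _ _); apply: leq_sum => w.
  by rewrite !inE -ltnNge => /ltnW.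
rewrite mulnCA leq_pmul2l // => le_bad.
have good_bad : (#|good| + #|[predC good]| = #|U|)%N by rewrite cardC card_ord.
move: le_p le_bad good_bad.
by move: #|p| #|U| #|good| #|[predC good]| => x y z t; lia.
Qed.

End Block.

(** * Winning probability of the attack *)

Section WinProb.
Context {U : finType} {n k N s f : nat}.
Context (F : cyclic_acf U n k N s f).
Context (R : realType).

Lemma card_stored : (#|stored F| <= n)%N.
Proof.
rewrite -[leqRHS]card_ord -(fintype.card_image (@key_inj _ _ _ _ _ _ F)).
by apply/subset_leq_card/fintype.subsetP => u /existsP[i /eqP <-];
  apply: fintype.image_f.
Qed.

Lemma wins_game_attack m us u0 (w : loc_hash k N U * fp_hash s f U) :
  (k * (2 ^ s).-1 < m)%N -> has (everlasting F w) us ->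
  wins_game F w.1 w.2 (attack m us u0).
Proof.
move=> lem /hasP[q qus]; rewrite /everlasting /wins_game.
case ins: insertion => [beta|] // perp; rewrite initial_tablesE.
apply: wins_attack => //.
  move=> i j [eqb eqloc]; apply: (insertion_valid ins).
  by congr pair => //; rewrite !ffunE.
by apply/orP; right; apply/hasP; exists q.
Qed.

Lemma win_prob_le1 A : win_prob R F A <= 1.
Proof.
rewrite /win_prob; set x := #|_|; set y := #|_|.
have lexy : (x <= y)%N.
  apply/subset_leq_card/fintype.subsetP => w; rewrite !inE /wins_game /built.
  by case: insertion.
have [->|y_neq0] := eqVneq y 0%N; first by rewrite invr0 mulr0.
by rewrite ler_pdivrMr ?mul1r ?ler_nat // ltr0n lt0n.
Qed.

Hypothesis N_gt0 : (0 < N)%N.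

(** A feasible family of locations on the stored elements extends to [U], with location 0
    elsewhere. *)
Lemma card_built_gt0 :
  (0 < #|[pred w : loc_hash k N U * fp_hash s f U | built F w.1]|)%N.
Proof.
have [h insh] := insertion_feasible F.
pose hl : loc_hash k N U := [ffun b => [ffun u =>
  if [pick i | key F i == u] is Some i then h b i else Ordinal N_gt0]].
apply/card_gt0P; exists (hl, [ffun=> sel0 f]); rewrite inE /= /built.
suff -> : restrict_hash (key F) hl = h by [].
apply/ffunP => b; apply/ffunP => i; rewrite !ffunE.
case: pickP => [j /eqP/key_inj -> //|/(_ i)]; by rewrite eqxx.
Qed.

(** One factor 1/2 is for a block at most half stored, the other for an everlasting element among
    the at least [M / 2] remaining ones, since [(M / 2) P >= 1]. *)
Lemma win_prob_attack (P : R) (m M : nat) (u0 : U) :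
  (0 < k)%N -> (k * (2 ^ s).-1 < m)%N -> (0 < M <= #|U|)%N ->
  (4 * n <= #|U|)%N ->
  0 <= P <= 1 -> P * (k * (N * (2 ^ f) ^ (2 ^ s)))%:R <= n%:R ->
  2 <= M%:R * P ->
  4^-1 <= win_prob R F
    (Adversary (fun w : 'I_#|U|.-1.+1 => attack m (block u0 M w) u0)).
Proof.
move=> k_gt0 lem /andP[M_gt0 leMU] len P01 leP MP.
have V_gt0 : (0 < #|U|)%N by apply/card_gt0P; exists u0.
pose H : finType := (loc_hash k N U * fp_hash s f U)%type.
pose B := #|[pred w : H | built F w.1]|.
have B_gt0 : (0 < B)%N := card_built_gt0.
rewrite /win_prob /=.
rewrite (sum_pair_assoc (fun (w : 'I_#|U|.-1.+1) (h : H) =>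
  wins_game F h.1 h.2 (attack m (block u0 M w) u0))).
rewrite (sum_pair_assoc (fun (w : 'I_#|U|.-1.+1) (h : H) => built F h.1)).
rewrite sum_nat_const card_ord -/B.
rewrite ler_pdivlMr ?ltr0n ?muln_gt0 // mulrC ler_pdivrMr // -natrM ler_nat.
rewrite prednK //.
have half (w : 'I_#|U|) : (2 * count (stored F) (block u0 M w) <= M)%N ->
    (B <= 2 * #|[pred h : H |
       wins_game F h.1 h.2 (attack m (block u0 M w) u0)]|)%N.
  move=> sparse.
  pose Q := [seq u <- block u0 M w | ~~ stored F u].
  have uQ : uniq Q by rewrite filter_uniq // block_uniq.
  have nstQ : all (fun q => ~~ stored F q) Q by apply: filter_all.
  have leMQ : (M <= 2 * size Q)%N.
    have := count_predC (stored F) (block u0 M w); rewrite -[X in (_ + X)%N]size_filter -/Q.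
    by rewrite size_map size_iota => eqM; move: sparse; lia.
  have QP : 1 <= (size Q)%:R * P.
    move: leMQ; rewrite -(ler_nat R) natrM => leMQ.
    by case/andP: P01 => P_ge0 _; have := ler_wpM2r P_ge0 leMQ; lra.
  have fail_le := card_no_everlasting k_gt0 N_gt0 P01 leP uQ nstQ.
  have := le_trans fail_le (ler_wpM2r (ler0n _ _) (expr_onem_le_half P01 QP)).
  rewrite mulrC ler_pdivlMr // -natrM ler_nat.
  set win := #|[pred h : H | wins_game _ _ _ _]|.
  pose fail := #|[pred h : H | built F h.1 && ~~ has (everlasting F h) Q]|.
  rewrite -/fail -/B => le_fail.
  (* A built filter with an everlasting element in [Q] is beaten. *)
  have : (B <= fail + win)%N.
    rewrite -cardUI; apply: leq_trans (leq_addr _ _).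
    apply/subset_leq_card/fintype.subsetP => h; rewrite !inE => -> /=.
    case: hasP => //= -[q]; rewrite mem_filter => /andP[_ qb] everq.
    by apply: wins_game_attack => //; apply/hasP; exists q.
  by clearbody fail win B; lia.
have := @card_sparse_block _ u0 M (stored F) M_gt0
  (leq_trans (leq_mul (leqnn 4) card_stored) len).
set good := [pred w | _] => le_good.
apply: leq_trans (leq_mul le_good (leqnn B)) _.
rewrite -mulnA -[4%N]/(2 * 2)%N [leqRHS]mulnC -mulnA leq_pmul2l //.
rewrite -sum_nat_const big_distrr /= [leqRHS](bigID [in good]) /=.
by apply: leq_trans (leq_addr _ _); apply: leq_sum => w /half.
Qed.

End WinProb.

(** * Choice of parameters and constants *)

Theorem theorem9 (R : realType) (K : nat) (a b : R) :
  0 < a ->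
  exists (c p L : R) (C : nat -> R) (n0 : nat),
    [/\ 0 < c, 0 < p, 0 < L, forall s : nat, 0 < C s
      & 1 <= a -> forall s : nat, C s = C 0%N] /\
    forall (n k N s f : nat) (eps : R),
      (n0 <= n)%N ->
      (k <= K)%N ->
      a * n%:R <= N%:R <= b * n%:R ->
      0 < eps < 1 ->
      2 ^+ f = n%:R / (N%:R * eps) ->
      exists T : nat,
        c * (2 ^+ s / eps ^+ (2 ^ s)) <= T%:R
          <= C s * (2 ^+ s / eps ^+ (2 ^ s)) /\
        forall U : finType, L * (n + T)%:R <= #|U|%:R ->
          (exists A : adversary U,
             (forall w, makes_queries T (play A w)) /\
             forall F : cyclic_acf U n k N s f, p <= win_prob R F A) /\
          (forall F : cyclic_acf U n k N s f, p <= sustained_fpr R F).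
Proof.
(* Capped at 1, [a1] has powers at most 1, and equal to 1 if [1 <= a], which makes [C] constant. *)
move=> a_gt0; pose a1 : R := Num.min a 1.
have a1_gt0 : 0 < a1 by rewrite lt_min a_gt0 ltr01.
have a1_le1 : a1 <= 1 by rewrite ge_min lexx orbT.
have a1_lea : a1 <= a by rewrite ge_min lexx.
pose K1 : R := K.+1%:R.
have K1_gt0 : 0 < K1 by rewrite ltr0n.
have K1_ge1 : 1 <= K1 by rewrite ler1n.
(* [C] comes from [M <= 4 / P] and [K.+1 * 2 ^ s] queries per element; [L = 4] gives both
   [4 n <= #|U|] and [M <= #|U|]. *)
exists 1, 4^-1, 4, (fun s => 4 * K1 ^+ 2 / a1 ^+ (2 ^ s).-1), 1%N; split.
  split=> [||//|s|a_ge1 s] //.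
  - by rewrite invr_gt0.
  - by rewrite divr_gt0 ?mulr_gt0 ?exprn_gt0.
  - by have -> : a1 = 1 by [rewrite /a1 min_r]; rewrite !expr1n.
move=> n k N s f eps n_gt0 lekK /andP[leaN _] /andP[eps_gt0 eps_lt1] fE.
have nR_gt0 : 0 < n%:R :> R by rewrite ltr0n.
have NR_gt0 : 0 < N%:R :> R by apply: lt_le_trans leaN; rewrite mulr_gt0.
have N_gt0 : (0 < N)%N by rewrite -(ltr0n R).
pose e := (2 ^ s).-1.
have eE : (2 ^ s = e.+1)%N by rewrite prednK ?expn_gt0.
rewrite -/e eE.
pose y := eps ^+ e.+1; pose x := a1 ^+ e.
have y_gt0 : 0 < y by rewrite exprn_gt0.
have x_gt0 : 0 < x by rewrite exprn_gt0.
have y_le1 : y <= 1 by rewrite exprn_ile1 ?(ltW eps_gt0) ?(ltW eps_lt1).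
have x_le1 : x <= 1 by rewrite exprn_ile1 ?(ltW a1_gt0).
pose P := x * y / K1.
have P_gt0 : 0 < P by rewrite divr_gt0 ?mulr_gt0.
have P_le1 : P <= 1.
  rewrite ler_pdivrMr // mul1r (le_trans _ K1_ge1) //.
  by rewrite mulr_ile1 ?(ltW x_gt0) ?(ltW y_gt0).
have PE : P * (k * (N * (2 ^ f) ^ (2 ^ s)))%:R <= n%:R.
  (* With [2 ^ f = n / (N eps)] raised to the power [e.+1], the powers of [eps] cancel and one [N]
     cancels, leaving [e] ratios [a1 n / N <= 1]. *)
  have -> : P * (k * (N * (2 ^ f) ^ (2 ^ s)))%:R =
      (k%:R / K1) * (a1 * n%:R / N%:R) ^+ e * n%:R.
    rewrite !natrM eE !natrX fE /P /x /y !exprS !exprMn !exprVn !exprMn.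
    by field; rewrite nat1r ?expf_neq0 ?gt_eqF.
  have r_ge0 : 0 <= a1 * n%:R / N%:R by rewrite divr_ge0 ?mulr_ge0 ?(ltW a1_gt0).
  rewrite -[leRHS]mul1r ler_pM2r //; apply: mulr_ile1.
  - by rewrite divr_ge0 // ltW.
  - by rewrite exprn_ge0.
  - by rewrite ler_pdivrMr // mul1r ler_nat leqW.
  - by rewrite exprn_ile1 // ler_pdivrMr // mul1r (le_trans _ leaN) // ler_pM2r.
(* The least integer above [X]; it is at most [2 X] because [X >= 1]. *)
pose X := 2 / P; pose M := (Num.truncn X).+1.
have X_ge0 : 0 <= X by rewrite divr_ge0 ?ltW.
have ltXM : X < M%:R by rewrite truncnS_gt.
have leMX : M%:R <= 2 * X.
  have X_ge1 : 1 <= X by rewrite ler_pdivlMr // mul1r; lra.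
  by have /andP[] := truncn_itv X_ge0; rewrite -natr1; lra.
have MP : 2 <= M%:R * P by rewrite -ler_pdivrMr // ltW.
have XE : X * K1 = 2 * K1 ^+ 2 / (x * y).
  by rewrite /X /P invf_div expr2 !mulrA mulrAC.
(* [M] candidates, each queried [K.+1 * 2 ^ s] times, more than [k (2 ^ s - 1)]. *)
exists (M * (K.+1 * e.+1))%N; split.
  have -> : 2 ^+ s = e.+1%:R :> R by rewrite -eE natrX.
  have e_gt0 : 0 < e.+1%:R :> R by rewrite ltr0n.
  rewrite !natrM -/K1 -/y [M%:R * (K1 * _)]mulrA [_.+1%:R / y]mulrC.
  rewrite !mulrA !ler_pM2r // mul1r.
  apply/andP; split.
    apply: le_trans (_ : X * K1 <= _); last by rewrite ler_pM2r // ltW.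
    rewrite XE invfM !mulrA ler_peMl ?invr_ge0 ?(ltW y_gt0) //.
    rewrite ler_pdivlMr // mul1r (le_trans x_le1) //.
    by move: K1_ge1; nra.
  apply: le_trans (_ : 2 * X * K1 <= _); first by rewrite ler_pM2r.
  by rewrite -mulrA XE -!mulrA -invfM !mulrA; lra.
move=> U; rewrite -natrM ler_nat mulnDr => leU.
have len : (4 * n <= #|U|)%N by apply: leq_trans leU; apply: leq_addr.
have leM : (M <= #|U|)%N.
  apply: leq_trans leU; apply: leq_trans (leq_addl _ _).
  by rewrite mulnCA leq_pmulr // !muln_gt0.
have /card_gt0P[u0 _] : (0 < #|U|)%N by apply: leq_trans leM.
have lek : (k * (2 ^ s).-1 < K.+1 * e.+1)%N.
  by rewrite eE /= (leq_ltn_trans (leq_mul lekK (leqnn e))) // ltn_mul.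
pose A := Adversary (fun w : 'I_#|U|.-1.+1 =>
  attack (K.+1 * e.+1) (block u0 M w) u0).
have winA (F : cyclic_acf U n k N s f) : 4^-1 <= win_prob R F A.
  (* As [0 < n], some stored element has a table in a feasible placement. *)
  have k_gt0 : (0 < k)%N.
    have [h] := insertion_feasible F; case: insertion => // beta _.
    by apply: leq_ltn_trans (ltn_ord (beta (Ordinal n_gt0))).
  apply: (win_prob_attack F N_gt0 u0 k_gt0 lek _ len _ PE MP); first by rewrite leM.
  by rewrite ltW.
split=> [|F].
  exists A; split=> // w.
  rewrite -{1}(size_iota 0 M).
  rewrite -(size_map (fun j => nth u0 (enum U) ((w + j) %% #|U|))).
  exact: makes_queries_attack.
apply: le_trans (winA F) _; apply: ub_le_sup; last by exists A.
by exists 1 => _ [B _ <-]; apply: win_prob_le1.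
Qed.
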